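(* Let $k$ be a field and let $T$ be a totally ordered set. The full subcategory $\operatorname{mod} kT$ of finitely presented objects of $\operatorname{Mod} kT$ is abelian.
   Context: $\operatorname{Mod} kT$ is the category of functors from $T$ (viewed as a category with a unique morphism $x\to y$ whenever $x\le y$) to $k$-vector spaces. For $x\in T$, let $h^x=k_{[x,\infty)}$ be the representable functor, with value $k$ at all $t\ge x$ and $0$ elsewhere, with identity structure maps where possible. $\operatorname{mod} kT$ consists of those $M$ admitting an exact sequence $\bigoplus_{i=1}^m h^{x_i}\to\bigoplus_{j=1}^n h^{y_j}\to M\to 0$ with $x_i,y_j\in T$ and $m,n$ finite. *)

(* Defs.v *)
From HB Require Import structures.
From mathcomp Require Import all_boot all_order all_algebra.
From mathcomp Require Import boolp.

Set Implicit Arguments.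
Unset Strict Implicit.
Unset Printing Implicit Defensive.

Import Order.TTheory GRing.Theory.

Local Open Scope ring_scope.

(* [comp g f] is "g after f"; equality of morphisms is Leibniz equality. *)
Record preadditive := Preadditive {
  ob :> Type;
  hom : ob -> ob -> zmodType;
  idm : forall a, hom a a;
  comp : forall a b c, hom b c -> hom a b -> hom a c;
  comp_idl : forall a b (f : hom a b), comp (idm b) f = f;
  comp_idr : forall a b (f : hom a b), comp f (idm a) = f;
  compA : forall a b c d (h : hom c d) (g : hom b c) (f : hom a b),
    comp h (comp g f) = comp (comp h g) f;
  compDl : forall a b c (g g' : hom b c) (f : hom a b),
    comp (g + g') f = comp g f + comp g' f;
  compDr : forall a b c (g : hom b c) (f f' : hom a b),
    comp g (f + f') = comp g f + comp g f' }.

Arguments hom {p} a b.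
Arguments idm {p} a.
Arguments comp {p a b c} g f.

Definition full_subcategory (C : preadditive) (P : C -> Prop) : preadditive :=
  @Preadditive {a : C | P a} (fun a b => hom (sval a) (sval b))
    (fun a => idm (sval a)) (fun a b c g f => comp g f)
    (fun a b f => comp_idl f) (fun a b f => comp_idr f)
    (fun a b c d h g f => compA h g f)
    (fun a b c g g' f => compDl g g' f)
    (fun a b c g f f' => compDr g f f').

Section Abelian.
Variable C : preadditive.

Definition mono (a b : C) (f : hom a b) : Prop :=
  forall (x : C) (u v : hom x a), comp f u = comp f v -> u = v.

Definition epi (a b : C) (f : hom a b) : Prop :=
  forall (x : C) (u v : hom b x), comp u f = comp v f -> u = v.

Definition zero_object (z : C) : Prop :=
  forall a : C, (exists! f : hom z a, True) /\ (exists! f : hom a z, True).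

Definition biproduct (a b p : C) (i1 : hom a p) (i2 : hom b p)
    (p1 : hom p a) (p2 : hom p b) : Prop :=
  [/\ comp p1 i1 = idm a, comp p2 i2 = idm b, comp p1 i2 = 0,
      comp p2 i1 = 0 & comp i1 p1 + comp i2 p2 = idm p].

Definition kernel (n a b : C) (i : hom n a) (f : hom a b) : Prop :=
  comp f i = 0 /\
  forall (x : C) (g : hom x a), comp f g = 0 -> exists! u : hom x n, comp i u = g.

Definition cokernel (a b q : C) (p : hom b q) (f : hom a b) : Prop :=
  comp p f = 0 /\
  forall (x : C) (g : hom b x), comp g f = 0 -> exists! u : hom q x, comp u p = g.

(* An Ab-category is abelian when it has a zero object, binary biproducts,
   kernels and cokernels, and its monos are kernels and epis cokernels
   (Mac Lane, Categories for the Working Mathematician, VIII.3). *)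
Record abelian : Prop := Abelian {
  has_zero_object : exists z : C, zero_object z;
  has_biproducts : forall a b : C, exists (p : C) (i1 : hom a p) (i2 : hom b p)
    (p1 : hom p a) (p2 : hom p b), biproduct i1 i2 p1 p2;
  has_kernels : forall (a b : C) (f : hom a b),
    exists (n : C) (i : hom n a), kernel i f;
  has_cokernels : forall (a b : C) (f : hom a b),
    exists (q : C) (p : hom b q), cokernel p f;
  mono_is_kernel : forall (a b : C) (f : hom a b), mono f ->
    exists (c : C) (g : hom b c), kernel f g;
  epi_is_cokernel : forall (a b : C) (f : hom a b), epi f ->
    exists (c : C) (g : hom c a), cokernel f g }.

End Abelian.

Lemma linear_ext (k : pzRingType) (U V : lmodType k) (f g : {linear U -> V}) :
  f =1 g -> f = g.
Proof.
case: f g => [f [[fD] [fZ]]] [g [[gD] [gZ]]] /= /funext fg.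
case: _ / fg gD gZ => gD gZ.
by rewrite (Prop_irrelevance fD gD) (Prop_irrelevance fZ gZ).
Qed.

Section Modules.
Variables (k : fieldType) (d : Order.disp_t) (T : orderType d).

Record kTmod := KTmod {
  value :> T -> lmodType k;
  smap : forall x y : T, (x <= y)%O -> {linear value x -> value y};
  smap_id : forall (x : T) (h : (x <= x)%O) v, smap h v = v;
  smap_comp : forall (x y z : T) (hxy : (x <= y)%O) (hyz : (y <= z)%O)
    (hxz : (x <= z)%O) v, smap hyz (smap hxy v) = smap hxz v }.

Record natural (M N : kTmod) := Natural {
  component :> forall t : T, {linear M t -> N t};
  naturality : forall (x y : T) (h : (x <= y)%O) v,
    component y (smap M h v) = smap N h (component x v) }.

Lemma natural_ext (M N : kTmod) (f g : natural M N) :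
  (forall t, f t =1 g t) -> f = g.
Proof.
case: f g => [f fN] [g gN] /= fg.
have efg : f = g.
  by apply: functional_extensionality_dep => t; apply: linear_ext; apply: fg.
case: _ / efg gN {fg} => gN.
by rewrite (Prop_irrelevance fN gN).
Qed.

Section HomGroup.
Variables M N : kTmod.

Definition nat_zero : natural M N :=
  @Natural M N (fun t => \0) (fun x y h v => esym (linear0 (smap N h))).

Lemma nat_opp_subproof (f : natural M N) x y (h : (x <= y)%O) v :
  - f y (smap M h v) = smap N h (- f x v).
Proof. by rewrite linearN naturality. Qed.

Definition nat_opp (f : natural M N) : natural M N :=
  @Natural M N (fun t => \- f t) (@nat_opp_subproof f).

Lemma nat_add_subproof (f g : natural M N) x y (h : (x <= y)%O) v :
  f y (smap M h v) + g y (smap M h v) = smap N h (f x v + g x v).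
Proof. by rewrite linearD !naturality. Qed.

Definition nat_add (f g : natural M N) : natural M N :=
  @Natural M N (fun t => f t \+ g t) (@nat_add_subproof f g).

Lemma nat_addA : associative nat_add.
Proof. by move=> f g h; apply: natural_ext => t v /=; rewrite addrA. Qed.

Lemma nat_addC : commutative nat_add.
Proof. by move=> f g; apply: natural_ext => t v /=; rewrite addrC. Qed.

Lemma nat_add0 : left_id nat_zero nat_add.
Proof. by move=> f; apply: natural_ext => t v /=; rewrite add0r. Qed.

Lemma nat_addN : left_inverse nat_zero nat_opp nat_add.
Proof. by move=> f; apply: natural_ext => t v /=; rewrite addNr. Qed.

HB.instance Definition _ := gen_eqMixin (natural M N).
HB.instance Definition _ := gen_choiceMixin (natural M N).
HB.instance Definition _ := GRing.isZmodule.Build (natural M N)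
  nat_addA nat_addC nat_add0 nat_addN.

End HomGroup.

Definition nat_id (M : kTmod) : natural M M :=
  @Natural M M (fun t => idfun) (fun x y h v => erefl).

Lemma nat_comp_subproof (L M N : kTmod) (g : natural M N) (f : natural L M)
    x y (h : (x <= y)%O) v :
  g y (f y (smap L h v)) = smap N h (g x (f x v)).
Proof. by rewrite !naturality. Qed.

Definition nat_comp (L M N : kTmod) (g : natural M N) (f : natural L M) :
    natural L N :=
  @Natural L N (fun t => g t \o f t) (@nat_comp_subproof L M N g f).

Lemma nat_comp_idl M N (f : natural M N) : nat_comp (nat_id N) f = f.
Proof. exact: natural_ext. Qed.

Lemma nat_comp_idr M N (f : natural M N) : nat_comp f (nat_id M) = f.
Proof. exact: natural_ext. Qed.

Lemma nat_compA K L M N (h : natural M N) (g : natural L M) (f : natural K L) :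
  nat_comp h (nat_comp g f) = nat_comp (nat_comp h g) f.
Proof. exact: natural_ext. Qed.

Lemma nat_compDl L M N (g g' : natural M N) (f : natural L M) :
  nat_comp (g + g') f = nat_comp g f + nat_comp g' f.
Proof. exact: natural_ext. Qed.

Lemma nat_compDr L M N (g : natural M N) (f f' : natural L M) :
  nat_comp g (f + f') = nat_comp g f + nat_comp g f'.
Proof. by apply: natural_ext => t v /=; rewrite linearD. Qed.

Definition Mod_kT : preadditive :=
  @Preadditive kTmod (fun M N => natural M N) nat_id nat_comp
    nat_comp_idl nat_comp_idr nat_compA nat_compDl nat_compDr.

Definition line (b : bool) : lmodType k :=
  if b then (k^o : lmodType k) else ('rV[k]_0 : lmodType k).

Definition line_map (b c : bool) : {linear line b -> line c} :=
  match b, c with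
  | true, true => idfun : {linear k^o -> k^o}
  | b, c => \0
  end.

Lemma line_map_id b v : line_map b b v = v.
Proof. by case: b v => //= v; apply/esym/thinmx0. Qed.

Lemma line_map_comp a b c v :
  a ==> b -> b ==> c -> line_map b c (line_map a b v) = line_map a c v.
Proof. by case: a b c v => [] [] []. Qed.

Section Representable.
Variable x : T.

Lemma representable_id (s : T) (h : (s <= s)%O) v :
  line_map (x <= s)%O (x <= s)%O v = v.
Proof. exact: line_map_id. Qed.

Lemma representable_comp (s t u : T) (hst : (s <= t)%O) (htu : (t <= u)%O)
    (hsu : (s <= u)%O) v :
  line_map (x <= t)%O (x <= u)%O (line_map (x <= s)%O (x <= t)%O v) =
  line_map (x <= s)%O (x <= u)%O v.
Proof. by apply: line_map_comp; apply/implyP => /le_trans; apply. Qed.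

(* The functor h^x = k_[x, oo). *)
Definition representable : kTmod :=
  @KTmod (fun t => line (x <= t)%O)
    (fun s t _ => line_map (x <= s)%O (x <= t)%O)
    representable_id representable_comp.

End Representable.

Definition zero_mod : kTmod :=
  @KTmod (fun t => 'rV[k]_0) (fun s t _ => idfun)
    (fun x h v => erefl) (fun x y z hxy hyz hxz v => erefl).

Section DirectSum.
Variables M N : kTmod.

Definition dsum_fun (s t : T) (h : (s <= t)%O) (v : M s * N s) : M t * N t :=
  (smap M h v.1, smap N h v.2).

Lemma dsum_fun_linear s t h : linear (@dsum_fun s t h).
Proof. by move=> a u v; rewrite /dsum_fun /= !linearP. Qed.

HB.instance Definition _ s t h :=
  GRing.isLinear.Build k (M s * N s)%type (M t * N t)%type *:%R
    (@dsum_fun s t h) (@dsum_fun_linear s t h).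

Lemma dsum_fun_id s (h : (s <= s)%O) v : dsum_fun h v = v.
Proof. by case: v => v w; rewrite /dsum_fun /= !smap_id. Qed.

Lemma dsum_fun_comp s t u (hst : (s <= t)%O) (htu : (t <= u)%O)
    (hsu : (s <= u)%O) v :
  dsum_fun htu (dsum_fun hst v) = dsum_fun hsu v.
Proof. by rewrite /dsum_fun /= !(smap_comp _ _ hsu). Qed.

Definition dsum : kTmod :=
  @KTmod (fun t => (M t * N t)%type) (fun s t h => @dsum_fun s t h)
    dsum_fun_id dsum_fun_comp.

End DirectSum.

(* The direct sum of the h^x, for x ranging over the finite family [xs]. *)
Definition representable_sum (xs : seq T) : kTmod :=
  foldr dsum zero_mod [seq representable x | x <- xs].

(* Exactness in a functor category is computed pointwise; below, exactness at M
   of [g] followed by the map to the zero functor says that [g] is onto. *)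
Definition exact_at (L M N : kTmod) (f : natural L M) (g : natural M N) : Prop :=
  forall (t : T) (v : M t), g t v = 0 <-> exists u : L t, f t u = v.

Definition finitely_presented (M : kTmod) : Prop :=
  exists (xs ys : seq T)
    (f : natural (representable_sum xs) (representable_sum ys))
    (g : natural (representable_sum ys) M),
    exact_at f g /\ exact_at g (nat_zero M zero_mod).

Definition mod_kT : preadditive :=
  full_subcategory (finitely_presented : Mod_kT -> Prop).

End Modules.

Arguments Mod_kT k {d} T.
Arguments mod_kT k {d} T.

(* Main.v *)
(** Call M tame along a finite set xs of points of T when every M(t) is
    finite-dimensional, M(t) = 0 as soon as t lies above no point of xs, and
    M(s) -> M(t) is bijective whenever no point of xs lies in ]s, t].  Tameness
    along xs passes to kernels, cokernels and finite direct sums, and survives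
    enlarging xs.  A tame M is generated by bases of the M(x), x in xs; the
    kernel of the resulting map from a sum of representables onto M is tame
    again, hence finitely generated.  So a module is finitely presented if and
    only if it is tame, and kernels and cokernels in mod kT are the pointwise
    ones. *)

From HB Require Import structures.
From mathcomp Require Import all_boot all_order all_algebra.
From mathcomp Require Import boolp.
Require Import Defs.

Set Implicit Arguments.
Unset Strict Implicit.
Unset Printing Implicit Defensive.

Import Order.TTheory GRing.Theory.

Local Open Scope ring_scope.

(** * Kernels and cokernels of linear maps, as modules *)

Section Kernel.
Variables (k : pzRingType) (U V : lmodType k) (f : {linear U -> V}).

Definition in_ker : {pred U} := fun u => f u == 0.

Lemma in_ker_submod : submod_closed in_ker.
Proof.
split=> [|a u v]; rewrite /in_ker unfold_in ?linear0// => /eqP fu /eqP fv.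
by rewrite unfold_in linearP fu fv scaler0 addr0.
Qed.

HB.instance Definition _ := GRing.isSubmodClosed.Build k U in_ker in_ker_submod.

Record ker := Ker { ker_val : U; _ : ker_val \in in_ker }.

HB.instance Definition _ := [isSub for ker_val].
HB.instance Definition _ := [Choice of ker by <:].
HB.instance Definition _ := [SubChoice_isSubLmodule of ker by <:].

Lemma kerP (u : ker) : f (val u) = 0.
Proof. exact/eqP/(valP u). Qed.

Lemma ker_intro u : f u = 0 -> u \in in_ker.
Proof. by move=> fu; apply/eqP. Qed.

End Kernel.

Section Cokernel.
Variables (k : pzRingType) (U V : lmodType k) (f : {linear U -> V}).

(** [Quotient.quot] takes a boolean predicate, hence the classical reflection of the existence of a
    preimage. *)
Definition in_im : {pred V} := fun v => `[< exists u, f u = v >].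

Lemma in_im_submod : submod_closed in_im.
Proof.
split=> [|a v w].
  by apply/asboolP; exists 0; rewrite linear0.
move=> /asboolP[u <-] /asboolP[u' <-].
by apply/asboolP; exists (a *: u + u'); rewrite linearP.
Qed.

HB.instance Definition _ := GRing.isSubmodClosed.Build k V in_im in_im_submod.

Local Open Scope quotient_scope.

Definition coker := Quotient.quot in_im.

HB.instance Definition _ := GRing.Zmodule.on coker.
HB.instance Definition _ := Quotient.on coker.

Definition coker_proj (v : V) : coker := \pi_coker v.

Lemma coker_proj_surj (q : coker) : exists v, coker_proj v = q.
Proof. by exists (repr q); apply: reprK. Qed.

Lemma coker_proj_eq v w : coker_proj v = coker_proj w <-> exists u, f u = v - w.
Proof.
split=> [/eqP|vw].
  by rewrite /coker_proj -Quotient.idealrBE => /asboolP.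
by apply/eqP; rewrite /coker_proj -Quotient.idealrBE; apply/asboolP.
Qed.

Lemma coker_projD : {morph coker_proj : v w / v + w}.
Proof. exact: raddfD. Qed.

(** Scalars act on a chosen representative. [coker_projZ] shows that the choice is harmless, and the
    module laws then descend from [V]. *)
Definition coker_scale a (q : coker) : coker := coker_proj (a *: repr q).

Lemma coker_projZ a v : coker_proj (a *: v) = coker_scale a (coker_proj v).
Proof.
apply/coker_proj_eq.
have /coker_proj_eq[u fu] : coker_proj v = coker_proj (repr (coker_proj v)).
  by rewrite /coker_proj reprK.
by exists (a *: u); rewrite linearZ_LR fu scalerBr.
Qed.

Lemma coker_scaleA a b q :
  coker_scale a (coker_scale b q) = coker_scale (a * b) q.
Proof. by have [v <-] := coker_proj_surj q; rewrite -!coker_projZ scalerA. Qed.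

Lemma coker_scale1 : left_id 1 coker_scale.
Proof.
by move=> q; have [v <-] := coker_proj_surj q; rewrite -coker_projZ scale1r.
Qed.

Lemma coker_scaleDr : right_distributive coker_scale +%R.
Proof.
move=> a p q.
have [v <-] := coker_proj_surj p; have [w <-] := coker_proj_surj q.
by rewrite -coker_projD -!coker_projZ -coker_projD scalerDr.
Qed.

Lemma coker_scaleDl q : {morph coker_scale^~ q : a b / a + b}.
Proof.
move=> a b; have [v <-] := coker_proj_surj q.
by rewrite -!coker_projZ -coker_projD scalerDl.
Qed.

HB.instance Definition _ := GRing.Zmodule_isLmodule.Build k coker
  coker_scaleA coker_scale1 coker_scaleDr coker_scaleDl.

Lemma coker_proj_linear : linear coker_proj.
Proof. by move=> a v w; rewrite coker_projD coker_projZ. Qed.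

HB.instance Definition _ := GRing.isLinear.Build k V coker *:%R
  coker_proj coker_proj_linear.

Lemma coker_proj_eq0 v : coker_proj v = 0 <-> exists u, f u = v.
Proof. by rewrite -(linear0 coker_proj) coker_proj_eq subr0. Qed.

End Cokernel.

(** * Product injections, lifts and descents of linear maps *)

Definition linear_of (k : pzRingType) (U V : lmodType k) (f : U -> V)
    (f_lin : linear f) : {linear U -> V} :=
  HB.pack_for {linear U -> V} f (GRing.isLinear.Build k U V *:%R f f_lin).

Section PairInjections.
Variables (k : pzRingType) (U V : lmodType k).

Lemma pair_inl_linear : linear (fun u : U => (u, 0 : V)).
Proof. by move=> a u v; congr pair; rewrite /= scaler0 addr0. Qed.

Lemma pair_inr_linear : linear (fun v : V => (0 : U, v)).
Proof. by move=> a u v; congr pair; rewrite /= scaler0 addr0. Qed.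

Definition pair_inl := linear_of pair_inl_linear.
Definition pair_inr := linear_of pair_inr_linear.

End PairInjections.

Section Factorization.
Variables (k : pzRingType) (U V W : lmodType k).

(** Preimages under [i] are picked pointwise; injectivity of [i] makes the choice linear. *)
Lemma linear_lift (i : {linear U -> V}) (g : {linear W -> V}) :
  injective i -> (forall w, exists u, i u = g w) ->
  exists h : {linear W -> U}, forall w, i (h w) = g w.
Proof.
move=> i_inj /choice[h ih].
have hlin : linear h by move=> a u v; apply: i_inj; rewrite ih !linearP !ih.
by exists (linear_of hlin).
Qed.

(** The chosen section [s] of [p] need not be linear, but [g] kills the kernel of [p], so [g \o s]
    is. *)
Lemma linear_descent (p : {linear U -> V}) (g : {linear U -> W}) :
  (forall v, exists u, p u = v) -> (forall u, p u = 0 -> g u = 0) ->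
  exists h : {linear V -> W}, forall u, h (p u) = g u.
Proof.
move=> /choice[s sK] gp.
have gs u : g (s (p u)) = g u.
  by apply/eqP; rewrite -subr_eq0 -linearB gp// linearB sK subrr.
have hlin : linear (g \o s).
  by move=> a u v /=; rewrite -linearP -[in RHS]gs linearP !sK.
by exists (linear_of hlin).
Qed.

End Factorization.

(** * Finite-dimensionality through spanning lists *)

Section FiniteSpan.
Variable k : fieldType.
Implicit Types U V : lmodType k.

(** Coefficients are split off one at a time, so that facts about spans follow by induction on the
    list, without indexed sums. *)
Fixpoint in_span V (vs : seq V) (u : V) : Prop :=
  if vs is v :: vs' then exists a, in_span vs' (u - a *: v) else u = 0.

Lemma in_spanP V (vs : seq V) a u w :
  in_span vs u -> in_span vs w -> in_span vs (a *: u + w).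
Proof.
elim: vs u w => [|v vs IH] u w /=; first by move=> -> ->; rewrite scaler0 addr0.
move=> [b hu] [c hw]; exists (a * b + c).
rewrite scalerDl -scalerA opprD addrACA -scalerBr; exact: IH.
Qed.

Lemma in_span_ind V (P : V -> Prop) (vs : seq V) u :
  P 0 -> (forall a v w, P v -> P w -> P (a *: v + w)) ->
  {in vs, forall v, P v} -> in_span vs u -> P u.
Proof.
move=> P0 PP; elim: vs u => [|v vs IH] u Pvs /=; first by move=> ->.
move=> [a hu]; rewrite -(subrK (a *: v) u) addrC.
apply: PP; first by apply: Pvs; rewrite mem_head.
by apply: IH hu => w wvs; apply: Pvs; rewrite inE wvs orbT.
Qed.

Lemma in_span_map U V (f : {linear U -> V}) us u :
  in_span us u -> in_span (map f us) (f u).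
Proof.
elim: us u => [|v us IH] u /=; first by move=> ->; rewrite linear0.
by move=> [a hu]; exists a; rewrite -linearZ -linearB; apply: IH.
Qed.

Lemma in_span_cat V (us vs : seq V) u v :
  in_span us u -> in_span vs v -> in_span (us ++ vs) (u + v).
Proof.
elim: us u => [|w us IH] u /=; first by move=> ->; rewrite add0r.
by move=> [a hu] hv; exists a; rewrite addrAC; apply: IH.
Qed.

Definition finite_span V : Prop := exists vs : seq V, forall v, in_span vs v.

Lemma finite_span_surj U V (f : {linear U -> V}) :
  (forall v, exists u, f u = v) -> finite_span U -> finite_span V.
Proof.
move=> fsurj [us hus]; exists (map f us) => v.
by have [u <-] := fsurj v; apply: in_span_map.
Qed.

Lemma finite_span_prod U V :
  finite_span U -> finite_span V -> finite_span (U * V)%type.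
Proof.
move=> [us hus] [vs hvs].
exists (map (pair_inl U V) us ++ map (pair_inr U V) vs) => -[u v].
have -> : (u, v) = pair_inl U V u + pair_inr U V v.
  by congr pair; rewrite ?addr0 ?add0r.
by apply: in_span_cat; apply: in_span_map.
Qed.

(* Induction on a spanning list of V, for all submodules P of U at once: a
   vector of P whose image leaves the span of the tail, if there is one, serves
   as a generator, and modulo it P maps into that span. *)
Lemma finite_span_inj U V (f : {linear U -> V}) :
  injective f -> finite_span V -> finite_span U.
Proof.
move=> f_inj [vs hvs].
suff gen : forall P : U -> Prop,
    (forall a u w, P u -> P w -> P (a *: u + w)) ->
    (forall u, P u -> in_span vs (f u)) ->
    exists us, forall u, P u -> in_span us u.
  by have [//|//|us hus] := gen (fun=> True); exists us => u; apply: hus.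
elim: {hvs} vs => [|v vs IH] P PP Pvs.
  by exists [::] => u /Pvs /=; rewrite -{1}(linear0 f) => /f_inj.
have [||us hus] := IH (fun u => P u /\ in_span vs (f u)).
- move=> a u w [Pu hu] [Pw hw]; split; first exact: PP.
  by rewrite linearP; apply: in_spanP.
- by move=> u [].
have [[w [Pw hw]]|nw] := pselect (exists w, P w /\ ~ in_span vs (f w));
    last first.
  exists us => u Pu; apply: hus; split=> //; apply: contrapT => nu.
  by apply: nw; exists u.
exists (w :: us) => u Pu.
have [/= a ha] := Pvs _ Pw; have [/= b hb] := Pvs _ Pu.
have a0 : a != 0.
  by apply: contra_notN hw => /eqP a0; move: ha; rewrite a0 scale0r subr0.
(* With [a] and [b] the coefficients of [v] found for [f w] and [f u], this multiple of [w] cancels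
   the [v]-part of [f u]. *)
exists (b / a); rewrite addrC -scaleNr; apply: hus; split; first exact: PP.
rewrite linearP.
have -> : - (b / a) *: f w + f u = - (b / a) *: (f w - a *: v) + (f u - b *: v).
  rewrite scalerBr scaleNr scalerA mulNr divfK// scaleNr opprK.
  by rewrite addrACA subrr addr0.
exact: in_spanP.
Qed.

End FiniteSpan.

(** * Pointwise kernels and cokernels of natural maps *)

Section Modules.
Variables (k : fieldType) (d : Order.disp_t) (T : orderType d).
Implicit Types (L M N : kTmod k T) (xs ys : seq T) (s t x y : T).

Definition pointwise_inj M N (f : natural M N) := forall t, injective (f t).

Definition pointwise_surj M N (f : natural M N) :=
  forall t v, exists u, f t u = v.

Lemma pointwise_inj_ker M N (f : natural M N) :
  (forall t v, f t v = 0 -> v = 0) -> pointwise_inj f.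
Proof.
move=> f0 t u v fuv; apply/eqP; rewrite -subr_eq0; apply/eqP/(f0 t).
by rewrite linearB /= fuv subrr.
Qed.

Lemma exact_at_zero_mod M N (f : natural M N) :
  exact_at f (nat_zero N (zero_mod k T)) <-> pointwise_surj f.
Proof.
by split=> [fE t v|fS t v]; [apply/(fE t v)|split=> // _; apply: fS].
Qed.

Section KernelModule.
Variables (M N : kTmod k T) (f : natural M N).

Lemma smap_in_ker s t (h : (s <= t)%O) (u : ker (f s)) :
  smap M h (val u) \in in_ker (f t).
Proof. by apply: ker_intro; rewrite naturality kerP linear0. Qed.

Definition ker_smap s t (h : (s <= t)%O) (u : ker (f s)) : ker (f t) :=
  Ker (smap_in_ker h u).

Lemma ker_smap_linear s t h : linear (@ker_smap s t h).
Proof. by move=> a u v; apply: val_inj; rewrite /= !linearP. Qed.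

HB.instance Definition _ s t h :=
  GRing.isLinear.Build k (ker (f s)) (ker (f t)) *:%R
    (@ker_smap s t h) (@ker_smap_linear s t h).

Lemma ker_smap_id s (h : (s <= s)%O) u : ker_smap h u = u.
Proof. by apply: val_inj; rewrite /= smap_id. Qed.

Lemma ker_smap_comp r s t (hrs : (r <= s)%O) (hst : (s <= t)%O)
  (hrt : (r <= t)%O) u : ker_smap hst (ker_smap hrs u) = ker_smap hrt u.
Proof. by apply: val_inj; rewrite /= (smap_comp _ _ hrt). Qed.

Definition ker_mod : kTmod k T :=
  @KTmod k d T (fun t => ker (f t)) (fun s t h => @ker_smap s t h)
    ker_smap_id ker_smap_comp.

Definition ker_incl : natural ker_mod M :=
  @Natural k d T ker_mod M (fun t => val : {linear ker (f t) -> M t})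
    (fun _ _ _ _ => erefl).

Lemma ker_incl_inj : pointwise_inj ker_incl.
Proof. by move=> t; apply: val_inj. Qed.

Lemma ker_incl_exact : exact_at ker_incl f.
Proof.
move=> t v; split=> [fv|[u <-]]; last exact: kerP.
by exists (Ker (ker_intro fv)).
Qed.

End KernelModule.

Section CokernelModule.
Variables (M N : kTmod k T) (f : natural M N).

(** By naturality [smap N h] carries the image of [f s] into that of [f t], hence descends to the
    quotients. *)
Lemma coker_smap_ex s t (h : (s <= t)%O) :
  exists g : {linear coker (f s) -> coker (f t)},
    forall v, g (coker_proj (f s) v) = coker_proj (f t) (smap N h v).
Proof.
apply: (linear_descent (g := coker_proj (f t) \o smap N h)).
  exact: coker_proj_surj.
move=> v /coker_proj_eq0[u <-]; apply/coker_proj_eq0.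
by exists (smap M h u); rewrite naturality.
Qed.

Definition coker_smap s t (h : (s <= t)%O) := sval (cid (coker_smap_ex h)).

Lemma coker_smapE s t (h : (s <= t)%O) v :
  coker_smap h (coker_proj (f s) v) = coker_proj (f t) (smap N h v).
Proof. by rewrite /coker_smap; case: cid. Qed.

Lemma coker_smap_id s (h : (s <= s)%O) q : coker_smap h q = q.
Proof. by have [v <-] := coker_proj_surj q; rewrite coker_smapE smap_id. Qed.

Lemma coker_smap_comp r s t (hrs : (r <= s)%O) (hst : (s <= t)%O)
  (hrt : (r <= t)%O) q : coker_smap hst (coker_smap hrs q) = coker_smap hrt q.
Proof.
by have [v <-] := coker_proj_surj q; rewrite !coker_smapE (smap_comp _ _ hrt).
Qed.

Definition coker_mod : kTmod k T :=
  @KTmod k d T (fun t => coker (f t)) coker_smap coker_smap_id coker_smap_comp.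

Definition coker_quot : natural N coker_mod :=
  @Natural k d T N coker_mod (fun t => coker_proj (f t))
    (fun _ _ h v => esym (coker_smapE h v)).

Lemma coker_quot_surj : pointwise_surj coker_quot.
Proof. by move=> t; apply: coker_proj_surj. Qed.

Lemma coker_quot_exact : exact_at f coker_quot.
Proof. by move=> t v; apply: coker_proj_eq0. Qed.

End CokernelModule.

(** * Unique factorization of natural maps *)

Section NaturalFactorization.
Variables L M N : kTmod k T.

(** Injectivity of [i] gives both the naturality of the pointwise lifts and their uniqueness. *)
Lemma natural_lift (i : natural L M) (g : natural N M) :
  pointwise_inj i -> (forall t w, exists u, i t u = g t w) ->
  exists! h : natural N L, nat_comp i h = g.
Proof.
move=> i_inj ig.
pose h t := sval (cid (linear_lift (@i_inj t) (ig t))).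
have hE t w : i t (h t w) = g t w by rewrite /h; case: cid.
have hN s t (hst : (s <= t)%O) w : h t (smap N hst w) = smap L hst (h s w).
  by apply: (i_inj t); rewrite naturality !hE naturality.
exists (Natural hN); split; first exact: natural_ext.
move=> h' h'E; apply: natural_ext => t w; apply: (i_inj t).
by rewrite /= hE -h'E.
Qed.

(** Dually, naturality and uniqueness are checked on elements [p t v], which exhaust [L t]. *)
Lemma natural_descent (p : natural M L) (g : natural M N) :
  pointwise_surj p -> (forall t v, p t v = 0 -> g t v = 0) ->
  exists! h : natural L N, nat_comp h p = g.
Proof.
move=> p_surj pg.
pose h t := sval (cid (linear_descent (p_surj t) (pg t))).
have hE t v : h t (p t v) = g t v by rewrite /h; case: cid.
have hN s t (hst : (s <= t)%O) w : h t (smap L hst w) = smap N hst (h s w).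
  by have [v <-] := p_surj s w; rewrite -naturality !hE naturality.
exists (Natural hN); split; first exact: natural_ext.
move=> h' h'E; apply: natural_ext => t w; have [v <-] := p_surj t w.
by rewrite /= hE -h'E.
Qed.

End NaturalFactorization.

(** * Tame modules and their stability properties *)

(* The hypothesis of the last clause: no point of xs lies in ]s, t]. *)
Definition tame xs M : Prop :=
  [/\ forall t, finite_span (M t),
      forall t (v : M t), {in xs, forall x, ~~ (x <= t)%O} -> v = 0 &
      forall s t (h : (s <= t)%O),
        {in xs, forall x, (x <= t)%O -> (x <= s)%O} ->
        injective (smap M h) /\ forall w, exists v, smap M h v = w].

Lemma tame_sub xs ys M : {subset xs <= ys} -> tame xs M -> tame ys M.
Proof.
move=> sxy [fM zM bM]; split=> // [t v nt|s t h nst].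
  by apply: zM => x /sxy; apply: nt.
by apply: bM => x /sxy; apply: nst.
Qed.

Lemma tame_cat xs ys M : tame xs M \/ tame ys M -> tame (xs ++ ys) M.
Proof.
by case; apply: tame_sub => x; rewrite mem_cat => ->; rewrite ?orbT.
Qed.

(** A diagram chase: injectivity on [L] comes from [M], while surjectivity uses surjectivity on [M]
    and injectivity on [N]. *)
Lemma tame_kernel xs L M N (i : natural L M) (f : natural M N) :
  pointwise_inj i -> exact_at i f -> tame xs M -> tame xs N -> tame xs L.
Proof.
move=> i_inj iE [fM zM bM] [fN zN bN]; split.
- by move=> t; apply: finite_span_inj (@i_inj t) (fM t).
- move=> t v nt; apply: (i_inj t); rewrite linear0; exact: zM.
move=> s t h nst; have [Minj Msurj] := bM s t h nst.
have [Ninj _] := bN s t h nst; split.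
  by move=> u v uv; apply/(i_inj s)/Minj; rewrite -!naturality uv.
move=> w; have [m hm] := Msurj (i t w).
(* The image of [f s m] in [N t] is [f t (i t w)], which vanishes. *)
have /iE[u iu] : f s m = 0.
  apply: Ninj; rewrite -naturality linear0 hm.
  by apply/iE; exists w.
by exists u; apply: (i_inj t); rewrite naturality iu.
Qed.

(** The dual chase: surjectivity on [N] comes from [M], while injectivity uses surjectivity on [L]
    and injectivity on [M]. *)
Lemma tame_cokernel xs L M N (f : natural L M) (p : natural M N) :
  exact_at f p -> pointwise_surj p -> tame xs L -> tame xs M -> tame xs N.
Proof.
move=> pE p_surj [fL zL bL] [fM zM bM]; split.
- by move=> t; apply: finite_span_surj (p_surj t) (fM t).
- by move=> t v nt; have [u <-] := p_surj t v; rewrite (zM t u nt) linear0.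
move=> s t h nst; have [Minj Msurj] := bM s t h nst.
have [_ Lsurj] := bL s t h nst; split; last first.
  move=> w; have [m <-] := p_surj t w; have [n <-] := Msurj m.
  by exists (p s n); rewrite naturality.
move=> u v uv; apply/eqP; rewrite -subr_eq0; apply/eqP.
have : smap N h (u - v) = 0 by rewrite linearB /= uv subrr.
have [m <-] := p_surj s (u - v); rewrite -naturality => /pE[l fl].
have [l' hl'] := Lsurj l; apply/pE; exists l'.
by apply: Minj; rewrite -naturality hl'.
Qed.

Lemma tame_zero_mod : tame [::] (zero_mod k T).
Proof.
split=> [t|t v _|s t h _]; first by exists [::] => v /=; apply: thinmx0.
  exact: thinmx0.
by split=> // w; exists w.
Qed.

Lemma tame_dsum xs M N : tame xs M -> tame xs N -> tame xs (dsum M N).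
Proof.
move=> [fM zM bM] [fN zN bN]; split=> [t|t [u v] nt|s t h nst].
- exact: finite_span_prod.
- by rewrite (zM t u nt) (zN t v nt).
have [Minj Msurj] := bM s t h nst; have [Ninj Nsurj] := bN s t h nst.
split=> [[u v] [u' v'] [/Minj -> /Ninj ->]|[u v]] //.
have [u' <-] := Msurj u; have [v' <-] := Nsurj v.
by exists (u', v').
Qed.

(** The functor changes only at [x]: if [x] is not in ]s, t], then [x <= s] and [x <= t] have the
    same truth value and the structure map is the identity. *)
Lemma tame_representable x : tame [:: x] (representable k x).
Proof.
split.
- move=> t /=; case: (x <= t)%O => /=; last first.
    by exists [::] => v; apply: thinmx0.
  by exists [:: 1 : k^o] => a; exists a; rewrite /= [_ *: _]mulr1 subrr.
- move=> t /= v /(_ x (mem_head _ _)); case: (x <= t)%O v => //= v _.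
  exact: thinmx0.
move=> s t h /(_ x (mem_head _ _)) xts /=.
have -> : (x <= t)%O = (x <= s)%O.
  by apply/idP/idP => // xs; apply: le_trans h.
by split=> [u v|w]; [rewrite !line_map_id|exists w; apply: line_map_id].
Qed.

Lemma tame_representable_sum xs : tame xs (representable_sum k xs).
Proof.
elim: xs => [|x xs IH]; first exact: tame_zero_mod.
apply: tame_dsum; last by apply: tame_sub IH => y; rewrite inE orbC => ->.
by apply: tame_sub (tame_representable x) => y; rewrite !inE => ->.
Qed.

End Modules.

(** * Yoneda maps, generators, and presentations of tame modules *)

Section Yoneda.
Variable k : fieldType.

(** When [b] holds, this sends 1 to [m]. The vector depends on a proof of [b] because, for [b] the
    truth value of [x <= t], it will be a transport [smap M hx m]. *)
Definition line_elim (b : bool) (V : lmodType k) :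
    (b -> V) -> {linear line k b -> V} :=
  match b with
  | true => fun m => linear_of (fun a (u v : k^o) =>
      etrans (scalerDl (m isT) (a * u) v)
        (congr1 (+%R^~ (v *: m isT)) (esym (scalerA a u (m isT)))))
  | false => fun=> \0
  end.

(** By cases on [b] and [c]; [b ==> c] rules out the case where the left side vanishes and the right
    side may not. *)
Lemma line_elim_map (b c : bool) (U V : lmodType k) (m : b -> U) (n : c -> V)
    (F : {linear U -> V}) v :
  b ==> c -> (forall hb hc, F (m hb) = n hc) ->
  line_elim n (line_map k b c v) = F (line_elim m v).
Proof.
case: b c m n v => [] [] m n v //= _ Fmn; rewrite ?linear0 ?scale0r //.
by rewrite linearZ_LR (Fmn isT isT).
Qed.

Lemma line_elim_gen (b : bool) (V : lmodType k) (m : b -> V) (h : b) :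
  exists v, line_elim m v = m h.
Proof.
case: b m h => //= m h; exists (1 : k^o).
by rewrite /= scale1r (bool_irrelevance h isT).
Qed.

Variables (d : Order.disp_t) (T : orderType d).
Implicit Types (M N : kTmod k T) (xs : seq T) (s t x : T).

Lemma yoneda_natural M x (m : M x) s t (h : (s <= t)%O) v :
  line_elim (fun hx => smap M hx m) (smap (representable k x) h v) =
  smap M h (line_elim (fun hx : (x <= s)%O => smap M hx m) v).
Proof.
apply: line_elim_map => [|hs ht]; last exact: smap_comp.
by apply/implyP => /le_trans; apply.
Qed.

(** The transformation that the Yoneda lemma attaches to [m]: the generator of h^x goes to [m]. *)
Definition yoneda M x (m : M x) : natural (representable k x) M :=
  @Natural k d T (representable k x) M
    (fun t => line_elim (fun hx : (x <= t)%O => smap M hx m))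
    (yoneda_natural m).

Definition copair_at L M N (f : natural L N) (g : natural M N) t
  (v : L t * M t) : N t := f t v.1 + g t v.2.

Lemma copair_at_linear L M N (f : natural L N) (g : natural M N) t :
  linear (@copair_at L M N f g t).
Proof.
by move=> a u v; rewrite /copair_at !linearP scalerDr addrACA.
Qed.

Lemma copair_natural L M N (f : natural L N) (g : natural M N) s t
  (h : (s <= t)%O) (v : dsum L M s) :
  copair_at f g (smap (dsum L M) h v) = smap N h (copair_at f g v).
Proof. by rewrite /copair_at linearD -!naturality. Qed.

Definition copair L M N (f : natural L N) (g : natural M N) :
    natural (dsum L M) N :=
  @Natural k d T (dsum L M) N
    (fun t => linear_of (@copair_at_linear L M N f g t))
    (copair_natural f g).

(** Each generator is packed with the point where it lives, so the list of tags determines the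
    source and both unfold together. *)
Fixpoint generated_by M (gens : seq {x : T & M x}) :
    natural (representable_sum k [seq tag g | g <- gens]) M :=
  match gens with
  | [::] => nat_zero (zero_mod k T) M
  | g :: gens' => copair (yoneda (tagged g)) (generated_by gens')
  end.

Lemma generated_by_mem M (gens : seq {x : T & M x}) (g : {x : T & M x}) t
    (h : (tag g <= t)%O) :
  g \in gens -> exists u, generated_by gens t u = smap M h (tagged g).
Proof.
elim: gens => //= g' gens IH; rewrite inE => /predU1P[<-|/IH[u hu]].
  have [v hv] := line_elim_gen (fun hx => smap M hx (tagged g)) h.
  by exists (v, 0); rewrite /= /copair_at /= hv linear0 addr0.
by exists (0, u); rewrite /= /copair_at /= linear0 add0r.
Qed.

(** Totality of the order gives the finitely many points of [xs] below [t] a maximum [x], if there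
    are any. No point of [xs] then lies in ]x, t]. *)
Lemma last_below xs t :
  {in xs, forall x, ~~ (x <= t)%O} \/
  exists x, [/\ x \in xs, (x <= t)%O &
                {in xs, forall y, (y <= t)%O -> (y <= x)%O}].
Proof.
elim: xs => [|x xs IH]; first by left.
have [xt|nxt] := boolP (x <= t)%O; last first.
  case: IH => [IH|[y [yxs yt ymax]]].
    by left=> y; rewrite inE => /predU1P[->|/IH].
  right; exists y; split=> // [|z]; first by rewrite inE yxs orbT.
  by rewrite inE => /predU1P[->|/ymax//]; rewrite (negPf nxt).
right; case: IH => [IH|[y [yxs yt ymax]]].
  exists x; split=> // [|z]; first exact: mem_head.
  by rewrite inE => /predU1P[-> //|/IH/negPf ->].
have [xy|/ltW yx] := leP x y.
  exists y; split=> // [|z]; first by rewrite inE yxs orbT.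
  by rewrite inE => /predU1P[-> //|/ymax].
exists x; split=> // [|z]; first exact: mem_head.
by rewrite inE => /predU1P[-> //|/ymax zy /zy /le_trans]; apply.
Qed.

(** Spanning lists of the [M x], for [x] in [xs], suffice: if [x] is the last point of [xs] below
    [t], then [M x] maps onto [M t]; if there is none, [M t] vanishes. *)
Lemma tame_generated xs M : tame xs M ->
  exists gens : seq {x : T & M x}, pointwise_surj (generated_by gens).
Proof.
move=> [fM zM bM].
have [gens hgens] : exists gens : seq {x : T & M x}, forall x, x \in xs ->
    exists vs : seq (M x), (forall v, in_span vs v) /\
      {in vs, forall v, Tagged (fun x => M x : Type) v \in gens}.
  elim: (xs) => [|y ys [gens IH]]; first by exists [::].
  have [vs hvs] := fM y.
  exists ([seq Tagged (fun x => M x : Type) v | v <- vs] ++ gens) => x.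
  rewrite inE => /predU1P[->|/IH[ws [hws sws]]].
    by exists vs; split=> // v vvs; rewrite mem_cat map_f.
  by exists ws; split=> // v /sws vgens; rewrite mem_cat vgens orbT.
exists gens => t v.
have [nt|[x [xxs xt xmax]]] := last_below xs t.
  by exists 0; rewrite linear0 (zM t v nt).
have [_ /(_ v)[w <-]] := bM x t xt xmax.
have [vs [/(_ w) hw svs]] := hgens x xxs.
(* These [m] form a submodule of [M x], so it is enough to find the spanning vectors [vs] in it. *)
pose P m := exists u, generated_by gens t u = smap M xt m.
apply: (in_span_ind (P := P) _ _ _ hw) => [|a u u' [p hp] [q hq]|u /svs].
- by exists 0; rewrite !linear0.
- by exists (a *: p + q); rewrite !linearP hp hq.
- exact: generated_by_mem.
Qed.

Lemma finitely_presented_tame M :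
  finitely_presented M <-> exists xs, tame xs M.
Proof.
split=> [[xs [ys [f [g [fg /exact_at_zero_mod g_surj]]]]]|[xs tM]].
  exists (xs ++ ys); apply: (tame_cokernel fg g_surj); apply: tame_cat.
    by left; apply: tame_representable_sum.
  by right; apply: tame_representable_sum.
have [gens g_surj] := tame_generated tM.
pose ys := [seq tag g | g <- gens].
(* [tame_kernel] asks for one list serving both the cover and [M]. *)
have tP : tame (ys ++ xs) (representable_sum k ys).
  by apply: tame_cat; left; apply: tame_representable_sum.
have tM' : tame (ys ++ xs) M by apply: tame_cat; right.
pose f := generated_by gens.
have tK :=
  tame_kernel (@ker_incl_inj _ _ _ _ _ f) (@ker_incl_exact _ _ _ _ _ f)
    tP tM'.
(* Generators of the kernel of the cover are the relations of the presentation. *)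
have [rels r_surj] := tame_generated tK.
exists [seq tag r | r <- rels], ys.
exists (nat_comp (ker_incl f) (generated_by rels)), f.
split; last exact/exact_at_zero_mod.
move=> t v; split=> [/ker_incl_exact[u <-]|[u <-]].
  by have [r <-] := r_surj t u; exists r.
by apply/ker_incl_exact; exists (generated_by rels t u).
Qed.

End Yoneda.

(** * Closure of finitely presented modules under kernels, cokernels and sums *)

Section FinitePresentation.
Variables (k : fieldType) (d : Order.disp_t) (T : orderType d).
Implicit Types M N : kTmod k T.

Lemma finitely_presented_tame2 M N :
  finitely_presented M -> finitely_presented N ->
  exists xs, tame xs M /\ tame xs N.
Proof.
move=> /finitely_presented_tame[xs tM] /finitely_presented_tame[ys tN].
by exists (xs ++ ys); split; apply: tame_cat; [left|right].
Qed.

Lemma finitely_presented_ker M N (f : natural M N) :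
  finitely_presented M -> finitely_presented N ->
  finitely_presented (ker_mod f).
Proof.
move=> pM pN; have [xs [tM tN]] := finitely_presented_tame2 pM pN.
apply/finitely_presented_tame; exists xs.
exact: tame_kernel (@ker_incl_inj _ _ _ _ _ f) (@ker_incl_exact _ _ _ _ _ f)
    tM tN.
Qed.

Lemma finitely_presented_coker M N (f : natural M N) :
  finitely_presented M -> finitely_presented N ->
  finitely_presented (coker_mod f).
Proof.
move=> pM pN; have [xs [tM tN]] := finitely_presented_tame2 pM pN.
apply/finitely_presented_tame; exists xs.
exact: tame_cokernel (@coker_quot_exact _ _ _ _ _ f)
  (@coker_quot_surj _ _ _ _ _ f) tM tN.
Qed.

Lemma finitely_presented_dsum M N :
  finitely_presented M -> finitely_presented N ->
  finitely_presented (dsum M N).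
Proof.
move=> pM pN; have [xs [tM tN]] := finitely_presented_tame2 pM pN.
by apply/finitely_presented_tame; exists xs; apply: tame_dsum.
Qed.

Lemma finitely_presented_zero : finitely_presented (zero_mod k T).
Proof. by apply/finitely_presented_tame; exists [::]; apply: tame_zero_mod. Qed.

(** * Pointwise exactness and categorical notions in mod kT *)

Local Notation C := (mod_kT k T).

(** The subcategory is full, so the factorization given by [natural_lift] is already a morphism in
    it. *)
Lemma kernel_of_exact (a b c : C) (i : hom a b) (f : hom b c) :
  pointwise_inj (i : natural _ _) -> exact_at (i : natural _ _) f -> kernel i f.
Proof.
move=> i_inj iE; split=> [|x g fg].
  by apply: natural_ext => t v /=; apply/iE; exists v.
apply: (natural_lift i_inj) => t w; apply/iE.
exact: (congr1 (fun h : natural _ _ => h t w) fg).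
Qed.

Lemma cokernel_of_exact (a b c : C) (f : hom a b) (p : hom b c) :
  exact_at (f : natural _ _) p -> pointwise_surj (p : natural _ _) ->
  cokernel p f.
Proof.
move=> pE p_surj; split=> [|x g gf].
  by apply: natural_ext => t v /=; apply/pE; exists v.
apply: (natural_descent p_surj) => t v /pE[u <-].
exact: (congr1 (fun h : natural _ _ => h t u) gf).
Qed.

Definition ker_ob (a b : C) (f : hom a b) : C :=
  exist _ _ (finitely_presented_ker f (svalP a) (svalP b)).

Definition coker_ob (a b : C) (f : hom a b) : C :=
  exist _ _ (finitely_presented_coker f (svalP a) (svalP b)).

(** The pointwise kernel lies in mod kT, so [f] can be tested on its inclusion: composed with [f] it
    agrees with 0, hence it is 0. *)
Lemma mono_pointwise_inj (a b : C) (f : hom a b) :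
  mono f -> pointwise_inj (f : natural _ _).
Proof.
move=> fm; apply: pointwise_inj_ker => t v /ker_incl_exact[u <-].
have i0 : ker_incl f = 0.
  apply: (fm (ker_ob f)); apply: natural_ext => s w /=.
  by rewrite linear0; apply/ker_incl_exact; exists w.
by rewrite i0.
Qed.

(** Dually, [f] is tested on the projection to its pointwise cokernel. *)
Lemma epi_pointwise_surj (a b : C) (f : hom a b) :
  epi f -> pointwise_surj (f : natural _ _).
Proof.
move=> fe t v; apply/coker_quot_exact.
have -> // : coker_quot f = 0.
apply: (fe (coker_ob f)); apply: natural_ext => s w /=.
by apply/coker_quot_exact; exists w.
Qed.

(** * Injections and projections of the direct sum *)

Lemma dsum_inl_natural M N s t (h : (s <= t)%O) (v : M s) :
  pair_inl (M t) (N t) (smap M h v) =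
  smap (dsum M N) h (pair_inl (M s) (N s) v).
Proof. by congr pair; rewrite /= linear0. Qed.

Definition dsum_inl M N : natural M (dsum M N) :=
  @Natural k d T M (dsum M N) (fun t => pair_inl (M t) (N t))
    (@dsum_inl_natural M N).

Lemma dsum_inr_natural M N s t (h : (s <= t)%O) (v : N s) :
  pair_inr (M t) (N t) (smap N h v) =
  smap (dsum M N) h (pair_inr (M s) (N s) v).
Proof. by congr pair; rewrite /= linear0. Qed.

Definition dsum_inr M N : natural N (dsum M N) :=
  @Natural k d T N (dsum M N) (fun t => pair_inr (M t) (N t))
    (@dsum_inr_natural M N).

Definition dsum_fst M N : natural (dsum M N) M :=
  @Natural k d T (dsum M N) M (fun t => fst : {linear (M t * N t)%type -> M t})
    (fun _ _ _ _ => erefl).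

Definition dsum_snd M N : natural (dsum M N) N :=
  @Natural k d T (dsum M N) N (fun t => snd : {linear (M t * N t)%type -> N t})
    (fun _ _ _ _ => erefl).

End FinitePresentation.

(** * Verification of the axioms of an abelian category *)

Theorem lemma3p5 (k : fieldType) (d : Order.disp_t) (T : orderType d) :
  abelian (mod_kT k T).
Proof.
split.
- exists (exist _ _ (finitely_presented_zero k T)) => a.
  split; exists 0; split=> // f _.
    by apply: natural_ext => t v /=; rewrite [v]thinmx0 linear0.
  by apply: natural_ext => t v /=; apply/esym/thinmx0.
- move=> a b; exists (exist _ _ (finitely_presented_dsum (svalP a) (svalP b))).
  exists (dsum_inl (sval a) (sval b)), (dsum_inr (sval a) (sval b)).
  exists (dsum_fst (sval a) (sval b)), (dsum_snd (sval a) (sval b)).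
  (* Four identities hold by computation; the decomposition of the identity is left, on pairs. *)
  split; apply: natural_ext => t //= -[u v] /=.
  by congr pair; rewrite /= ?addr0 ?add0r.
- move=> a b f; exists (ker_ob f), (ker_incl f).
  by apply: kernel_of_exact; [apply: ker_incl_inj|apply: ker_incl_exact].
- move=> a b f; exists (coker_ob f), (coker_quot f).
  by apply: cokernel_of_exact; [apply: coker_quot_exact|apply: coker_quot_surj].
(* A mono is the kernel of its cokernel. *)
- move=> a b f /mono_pointwise_inj f_inj; exists (coker_ob f), (coker_quot f).
  by apply: kernel_of_exact => //; apply: coker_quot_exact.
(* An epi is the cokernel of its kernel. *)
- move=> a b f /epi_pointwise_surj f_surj; exists (ker_ob f), (ker_incl f).
  by apply: cokernel_of_exact => //; apply: ker_incl_exact.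
Qed.
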